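(* Let $n\ge 1$ and let $(\alpha_2,\dots,\alpha_n)$ be an $(n-1)$-tuple of non-negative integers. Then the number of distinct conjugacy classes of words appearing in the multiset $\Phi(n^{\alpha_n}\cdots 3^{\alpha_3}2^{\alpha_2})$ is at most $\lceil (n-1)/2\rceil$.
   Context: Words are over the totally ordered alphabet $\{2<3<\cdots<n\}$; $n^{\alpha_n}\cdots 2^{\alpha_2}$ is the weakly decreasing word with $\alpha_i$ occurrences of the letter $i$. Two words are conjugate if they can be written $xy$ and $yx$; a conjugacy class of words is also called a necklace or circular word. The standard permutation $st(w)$ of a word $w=a_1\cdots a_N$ is the permutation of $\{1,\dots,N\}$ (in one-line notation) obtained by numbering the letters of $w$ by $1,2,\dots,N$, first numbering the occurrences of the smallest letter from left to right, then those of the second smallest letter from left to right, and so on (e.g. $st(baaacaba)=61238475$). The map $\Phi$: let $\tau=st(w)^{-1}$. To each cycle $(j_1,j_2,\dots,j_i)$ of $\tau$ (meaning $\tau(j_1)=j_2$, etc.; fixed points count as cycles) associate the necklace $(a_{j_1}a_{j_2}\cdots a_{j_i})$. Then $\Phi(w)$ is the multiset of necklaces obtained from all cycles of $\tau$ (they are always primitive). The count in the claim is without multiplicity. *)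

(* Defs.v *)
From HB Require Import structures.
From mathcomp Require Import all_boot fingroup perm finmap multiset.
From mathcomp Require Import generic_quotient.

Set Implicit Arguments.
Unset Strict Implicit.
Unset Printing Implicit Defensive.

(* Letters are natural numbers with their usual order.  Positions in a word
   [w], and the numbers assigned to them by the standard permutation, are
   counted from 0: the set {1, ..., N} becomes ['I_(size w)]. *)
Notation word := (seq nat).

Section Conjugacy.
Implicit Types u v w : word.

Definition conjugate u v : bool := [exists k : 'I_(size u).+1, v == rot k u].

Lemma conjugateP u v :
  reflect (exists x y, u = x ++ y /\ v = y ++ x) (conjugate u v).
Proof.
apply: (iffP existsP) => [[k /eqP->]|[x [y [-> ->]]]].
  by exists (take k u), (drop k u); rewrite cat_take_drop.
have lt_x : size x < (size (x ++ y)).+1 by rewrite size_cat ltnS leq_addr.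
by exists (Ordinal lt_x); rewrite rot_size_cat.
Qed.

Lemma conjugate_refl : reflexive conjugate.
Proof. by move=> u; apply/conjugateP; exists [::], u; rewrite cats0. Qed.

Lemma conjugate_sym : symmetric conjugate.
Proof.
by move=> u v; apply/conjugateP/conjugateP => -[x [y [-> ->]]]; exists y, x.
Qed.

Lemma conjugate_trans : transitive conjugate.
Proof.
move=> v u w /existsP[k /eqP->] /existsP[l /eqP->].
have le_k : k <= size u by rewrite -ltnS.
have: l < (size (rot k u)).+1 by [].
move: (val l) => {l} l; rewrite size_rot ltnS => le_l.
rewrite rot_add_mod //; set m := (if _ then _ else _).
by apply/conjugateP; exists (take m u), (drop m u); rewrite cat_take_drop.
Qed.

Definition conjugate_equiv : equiv_rel word :=
  EquivRel conjugate conjugate_refl conjugate_sym conjugate_trans.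

End Conjugacy.

Notation necklace := ({eq_quot conjugate_equiv})%qT.

Definition necklace_of (u : word) : necklace := (\pi_necklace u)%qT.

Section StandardPermutation.
Variable w : word.

Definition letter (i : 'I_(size w)) : nat := tnth (in_tuple w) i.

(* The positions of [w] in the order in which they receive their numbers:
   letter by letter in increasing order, and from left to right among the
   occurrences of a given letter. *)
Definition numbering : seq 'I_(size w) :=
  flatten [seq [seq i <- enum 'I_(size w) | letter i == a]
          | a <- sort leq (undup w)].

Lemma perm_numbering : perm_eq numbering (enum 'I_(size w)).
Proof.
apply/allP => i _ /=; rewrite count_flatten -map_comp.
have -> : count_mem i (enum 'I_(size w)) = 1.
  by rewrite count_uniq_mem ?enum_uniq // mem_enum.
rewrite (eq_map (g := fun a => pred1 (letter i) a : nat)); last first.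
  move=> a /=; rewrite count_uniq_mem; last exact/filter_uniq/enum_uniq.
  by rewrite mem_filter mem_enum andbT eq_sym.
rewrite (sumn_count (pred1 (letter i))) count_uniq_mem ?sort_uniq ?undup_uniq //.
by rewrite mem_sort mem_undup mem_tnth.
Qed.

Lemma mem_numbering i : i \in numbering.
Proof. by rewrite (perm_mem perm_numbering) mem_enum. Qed.

Lemma index_numbering i : index i numbering < size w.
Proof.
by rewrite -[X in _ < X]card_ord cardE -(perm_size perm_numbering)
  index_mem mem_numbering.
Qed.

Definition number (i : 'I_(size w)) : 'I_(size w) :=
  Ordinal (index_numbering i).

Lemma number_inj : injective number.
Proof.
move=> i j /(congr1 val) /= eq_ij.
by rewrite -(nth_index i (mem_numbering i)) eq_ij nth_index ?mem_numbering.
Qed.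

Definition st : {perm 'I_(size w)} := perm number_inj.

(* [froots tau] contains exactly one element of each cycle of [tau], and
   [orbit tau j] is the sequence j, tau j, tau (tau j), ... along its cycle. *)
Definition Phi : {mset necklace}%mset :=
  let tau : {perm 'I_(size w)} := (st^-1)%g in
  seq_mset [seq necklace_of [seq letter i | i <- orbit tau j]
           | j <- enum (froots tau)].

End StandardPermutation.

Definition distinct_necklaces (M : {mset necklace}%mset) : nat := #|` finsupp M|.

(* The word n^(alpha_n) ... 3^(alpha_3) 2^(alpha_2); the exponent alpha_i is
   the entry of index i - 2 of the tuple. *)
Definition decreasing_word (n : nat) (alpha : (n - 1).-tuple nat) : word :=
  flatten [seq nseq (tnth alpha i) i.+2 | i <- rev (enum 'I_(n - 1))].

(* Main.v *)
(* For a weakly decreasing word over m letters, T = st w is an interval exchange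
   reversing the order of the blocks of equal letters: writing S for the
   reversal of every block, T \o S reverses the whole set of positions.  So S
   and T \o S are involutions, T is their product, and the same description
   holds on every T-stable set of positions U.

   Taking for U a single cycle shows that each necklace of Phi(w) is equal to its
   mirror image.  Taking for U a union of cycles, one for each necklace, it
   follows that S maps each of them to itself.  On each cycle S and T \o S act
   as reflections generating a dihedral group, so they have two fixed points
   there in total.  But on U the map S has at most one fixed point in each block
   and T \o S at most one altogether, so twice the number of necklaces is at
   most m + 1. *)
Require Import Defs.
From mathcomp Require Import all_boot fingroup perm finmap multiset.
From mathcomp Require Import generic_quotient zify.

Set Implicit Arguments.
Unset Strict Implicit.
Unset Printing Implicit Defensive.

(** * Monotone maps and order reversals on finite sets of positions *)

Section Ordinals.
Variable N : nat.
Implicit Types (x y : 'I_N) (A : {set 'I_N}).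

(** If [x < f x], monotonicity gives [f x < f (f x)] and so on, an endless ascent inside ['I_N];
    [f x < x] gives an endless descent. *)
Lemma homo_lt_id A (f : 'I_N -> 'I_N) :
    {in A, forall x, f x \in A} ->
    {in A &, forall x y, x < y -> f x < f y} ->
  {in A, forall x, f x = x}.
Proof.
move=> fA f_lt x xA; apply/val_inj/eqP => /=; rewrite eqn_leq.
apply/andP; split; rewrite leqNgt; apply/negP.
- have [n] := ubnP (N - x); elim: n x xA => // n IHn x xA le_n lt_x.
  have lt_fx := f_lt x (f x) xA (fA x xA) lt_x.
  apply: (IHn (f x)) lt_fx; first exact: fA.
  by rewrite ltnS in le_n; apply: leq_trans le_n; apply: ltn_sub2l.
- have [n] := ubnP (val x); elim: n x xA => // n IHn x xA le_n lt_x.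
  have lt_fx := f_lt (f x) x (fA x xA) xA lt_x.
  apply: (IHn (f x)) lt_fx; first exact: fA.
  by rewrite ltnS in le_n; apply: leq_trans le_n.
Qed.

(** Outside [A] the index overflows and the default [x] is returned, so such points are fixed. *)
Definition reversal A x : 'I_N := nth x (rev (enum A)) (index x (enum A)).

Lemma reversal_in A : {in A, forall x, reversal A x \in A}.
Proof.
move=> x xA; rewrite -mem_enum -mem_rev mem_nth // size_rev index_mem.
by rewrite mem_enum.
Qed.

Lemma sorted_enum_set A : sorted (relpre val ltn) (enum A).
Proof.
have sN : sorted (relpre val ltn) (enum 'I_N).
  by rewrite -sorted_map val_enum_ord iota_ltn_sorted.
rewrite /enum_mem -enumT; apply: sorted_filter sN.
by move=> ? ? ?; apply: ltn_trans.
Qed.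

Lemma reversal_lt A : {in A &, forall x y, x < y -> reversal A y < reversal A x}.
Proof.
move=> x y xA yA lt_xy; have lt_tr : transitive (relpre (@nat_of_ord N) ltn).
  by move=> ? ? ?; apply: ltn_trans.
have idx z : z \in A -> index z (enum A) < size (enum A).
  by rewrite index_mem mem_enum.
have lt_i : index x (enum A) < index y (enum A).
  rewrite ltnNge leq_eqVlt; apply/negP => /predU1P[eq_i|lt_i].
    move: (congr1 (nth x (enum A)) eq_i).
    by rewrite !nth_index ?mem_enum // => eq_yx; rewrite eq_yx ltnn in lt_xy.
  have := sorted_ltn_index lt_tr (sorted_enum_set A).
  move=> /(_ y x); rewrite !mem_enum => /(_ yA xA lt_i) /=.
  by rewrite ltnNge ltnW.
rewrite /reversal (set_nth_default x) ?size_rev ?idx // !nth_rev ?idx //.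
apply: (sorted_ltn_nth lt_tr x (sorted_enum_set A)); rewrite ?inE.
- by rewrite ltn_subrL /=; apply: leq_ltn_trans (idx _ xA).
- by rewrite ltn_subrL /=; apply: leq_ltn_trans (idx _ xA).
- by apply: ltn_sub2l => //; apply: leq_ltn_trans (idx _ yA).
Qed.

End Ordinals.

(** * Interval exchanges that reverse the order of the blocks *)

Section DiscreteInterval.
Variables (N : nat) (T : {perm 'I_N}) (a : 'I_N -> nat).
Hypothesis a_anti : forall x y : 'I_N, x < y -> a y <= a x.
Hypothesis T_lt_letter : forall x y, a x < a y -> T x < T y.
Hypothesis T_lt_block : forall x y : 'I_N, a x = a y -> x < y -> T x < T y.

Let tau : {perm 'I_N} := (T^-1)%g.

Let tauK : cancel tau T. Proof. exact: permKV. Qed.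
Let TK : cancel T tau. Proof. exact: permK. Qed.

Section Reversal.
Variable U : {set 'I_N}.
Hypothesis TU : {in U, forall x, T x \in U}.

Definition block_reversal x := reversal [set y in U | a y == a x] x.
Local Notation S := block_reversal.

Lemma block_reversal_spec x : x \in U -> S x \in U /\ a (S x) = a x.
Proof.
move=> xU; have := @reversal_in _ [set y in U | a y == a x] x.
by rewrite !inE xU eqxx => /(_ isT) /andP[-> /eqP->].
Qed.

Lemma block_reversal_in : {in U, forall x, S x \in U}.
Proof. by move=> x /block_reversal_spec[]. Qed.

Lemma letter_block_reversal : {in U, forall x, a (S x) = a x}.
Proof. by move=> x /block_reversal_spec[]. Qed.

Lemma block_reversal_lt :
  {in U &, forall x y : 'I_N, a x = a y -> x < y -> S y < S x}.
Proof.
move=> x y xU yU eq_a lt_xy; rewrite /S -eq_a.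
by apply: reversal_lt; rewrite ?inE ?xU ?yU ?eq_a ?eqxx.
Qed.

(** On a single block [S] reverses the order, so [S \o S] preserves it and [homo_lt_id] applies. *)
Lemma block_reversalK : {in U, involutive S}.
Proof.
move=> x xU; pose A := [set y in U | a y == a x].
have SA y : y \in A -> S y \in A.
  rewrite !inE => /andP[yU /eqP <-].
  by rewrite block_reversal_in // letter_block_reversal ?eqxx.
apply: (@homo_lt_id _ A (S \o S)); last by rewrite inE xU /=.
  by move=> y yA; apply/SA/SA.
move=> y z yA zA lt_yz /=.
have eqA u v : u \in A -> v \in A -> a u = a v.
  by rewrite !inE => /andP[_ /eqP->] /andP[_ /eqP->].
have AU u : u \in A -> u \in U by rewrite inE => /andP[].
have SyA := SA y yA; have SzA := SA z zA.
have lt_S := block_reversal_lt (AU y yA) (AU z zA) (eqA y z yA zA) lt_yz.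
exact: block_reversal_lt (AU _ SzA) (AU _ SyA) (eqA _ _ SzA SyA) lt_S.
Qed.

Lemma T_block_reversal_lt :
  {in U &, forall x y : 'I_N, x < y -> T (S y) < T (S x)}.
Proof.
move=> x y xU yU lt_xy; have := a_anti lt_xy; rewrite leq_eqVlt.
case/predU1P => [eq_a|lt_a]; last first.
  by apply: T_lt_letter; rewrite !letter_block_reversal.
apply: T_lt_block; first by rewrite !letter_block_reversal.
exact: block_reversal_lt.
Qed.

(* A composite of two order-reversing self-maps of the finite set [U] preserves
   its order, hence is the identity. *)
Lemma T_block_reversalK : {in U, forall x, T (S (T (S x))) = x}.
Proof.
have TSU y : y \in U -> T (S y) \in U by move=> ?; apply/TU/block_reversal_in.
apply: homo_lt_id => [x xU|x y xU yU lt_xy]; first exact/TSU/TSU.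
by apply: T_block_reversal_lt; rewrite ?TSU //; apply: T_block_reversal_lt.
Qed.

Lemma iter_T_in k : {in U, forall x, iter k T x \in U}.
Proof. by move=> x xU; elim: k => //= k; apply: TU. Qed.

(** [S] and [T \o S] are involutions on [U], so [S] conjugates [T] to its inverse [tau]. *)
Lemma iter_tau_block_reversal k :
  {in U, forall x, iter k tau (S x) = S (iter k T x)}.
Proof.
move=> x xU; elim: k => //= k ->; set y := iter k T x.
have yU : y \in U by apply: iter_T_in.
have := T_block_reversalK (block_reversal_in yU).
by rewrite (block_reversalK yU) => /(canRL TK)->.
Qed.

Lemma iter_tauK k : cancel (iter k tau) (iter k T).
Proof. by elim: k => // k IHk x; rewrite iterSr iterS tauK IHk. Qed.

Lemma order_leq_iter x n : 0 < n -> iter n tau x = x -> fingraph.order tau x <= n.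
Proof.
move=> n_gt0 iter_x; rewrite leqNgt; apply/negP => /findex_iter.
by rewrite iter_x findex0 => n0; rewrite -n0 in n_gt0.
Qed.

Lemma iter_T_order x : iter (fingraph.order tau x) T x = x.
Proof. by rewrite -{2}(@iter_order _ tau perm_inj x) iter_tauK. Qed.

Lemma order_block_reversal : {in U, forall x, fingraph.order tau (S x) = fingraph.order tau x}.
Proof.
have le_order x : x \in U -> fingraph.order tau (S x) <= fingraph.order tau x.
  move=> xU; apply: order_leq_iter; first exact: fingraph.order_gt0.
  by rewrite iter_tau_block_reversal // iter_T_order.
move=> x xU; apply/eqP; rewrite eqn_leq le_order //=.
by rewrite -{1}(block_reversalK xU) le_order ?block_reversal_in.
Qed.

(** The right-hand side is free of [U], which allows the reversals of two different stable sets to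
    be compared. *)
Lemma word_block_reversal : {in U, forall x,
  [seq a y | y <- orbit tau (S x)]
    = mkseq (fun k => a (iter k T x)) (fingraph.order tau x)}.
Proof.
move=> x xU; apply: (@eq_from_nth _ 0).
  by rewrite size_map size_orbit size_mkseq order_block_reversal.
rewrite size_map size_orbit => k lt_k.
rewrite (nth_map (S x)) ?size_orbit //; rewrite /orbit nth_traject // nth_mkseq; last first.
  by rewrite -order_block_reversal.
by rewrite iter_tau_block_reversal // letter_block_reversal // iter_T_in.
Qed.

Lemma block_reversal_fixed_uniq :
  {in U &, forall x y, a x = a y -> S x = x -> S y = y -> x = y}.
Proof.
move=> x y xU yU eq_a Sx Sy; apply/val_inj/eqP.
case: ltngtP => // lt_xy.
  by have := block_reversal_lt xU yU eq_a lt_xy; rewrite Sx Sy ltnNge ltnW.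
by have := block_reversal_lt yU xU (esym eq_a) lt_xy; rewrite Sx Sy ltnNge ltnW.
Qed.

Lemma T_block_reversal_fixed_uniq :
  {in U &, forall x y, T (S x) = x -> T (S y) = y -> x = y}.
Proof.
move=> x y xU yU Sx Sy; apply/val_inj/eqP.
case: ltngtP => // lt_xy.
  by have := T_block_reversal_lt xU yU lt_xy; rewrite Sx Sy ltnNge ltnW.
by have := T_block_reversal_lt yU xU lt_xy; rewrite Sx Sy ltnNge ltnW.
Qed.

Lemma tau_in : {in U, forall x, tau x \in U}.
Proof.
(* By finiteness [tau x] is itself a forward iterate of [T] at [x], namely the one just before the
   cycle closes. *)
move=> x xU; have := iter_T_order x; rewrite -(prednK (fingraph.order_gt0 tau x)) iterS.
by move=> /(canRL TK) <-; apply: iter_T_in.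
Qed.

Lemma iter_tau_in k : {in U, forall x, iter k tau x \in U}.
Proof. by move=> x xU; elim: k => //= k; apply: tau_in. Qed.

(* On a cycle on which [S] acts, it is [tau^i x |-> tau^(k-i) x], and [T \o S] is
   [tau^i x |-> tau^(k-1-i) x]. *)
Lemma iter_half_fixed x k : x \in U -> S x = iter k tau x ->
  let y := iter k./2 tau x in if odd k then T (S y) = y else S y = y.
Proof.
move=> xU Sx y; have yU : y \in U by apply: iter_tau_in.
have Sy : S y = iter (uphalf k) tau x.
  (* [iter k./2 tau (S y)] is [S x], that is [iter k tau x]; undoing [k./2] steps leaves
     [uphalf k]. *)
  have := iter_tau_block_reversal k./2 yU; rewrite iter_tauK Sx.
  move/(congr1 (iter k./2 T)); rewrite iter_tauK => ->.
  rewrite -(iter_tauK k./2 (iter (uphalf k) tau x)) -iterD.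
  by rewrite uphalf_half addnCA addnn odd_double_half.
by rewrite Sy uphalf_half; case: odd => //=; rewrite tauK.
Qed.

End Reversal.

(** * Necklaces read along the cycles, and the count of fixed points *)

Definition orbit_necklace x : necklace := necklace_of [seq a y | y <- orbit tau x].
Local Notation g := orbit_necklace.

Lemma orbit_necklace_fconnect x y : fconnect tau x y -> g x = g y.
Proof.
rewrite fconnect_orbit => xy; have tau_inj : injective tau by apply: perm_inj.
have [k eq_y] := orbit_rot_cycle (cycle_orbit tau_inj x) (orbit_uniq tau x) xy.
rewrite /g eq_y map_rot; apply/eqquotP/conjugateP.
by exists (take k (map a (orbit tau x))), (drop k (map a (orbit tau x)));
  rewrite cat_take_drop.
Qed.

Lemma fconnect_T x y : fconnect tau x (T y) = fconnect tau x y.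
Proof. by rewrite (same_fconnect1_r (@perm_inj _ tau)) TK. Qed.

(* The letters along the orbit of [S x] are those along the orbit of [x] read
   backwards, whichever [T]-stable set containing [x] is used to define [S];
   for that set reduced to the orbit of [x], the point [S x] lies on it. *)
Lemma orbit_necklace_block_reversal (U : {set 'I_N}) :
  {in U, forall x, T x \in U} ->
  {in U, forall x, g (block_reversal U x) = g x}.
Proof.
move=> TU x xU; pose O := [set y | fconnect tau x y].
have TO : {in O, forall y, T y \in O} by move=> y; rewrite !inE fconnect_T.
have xO : x \in O by rewrite inE.
have := block_reversal_in xO; rewrite inE => /orbit_necklace_fconnect ->.
by rewrite /g !word_block_reversal.
Qed.

Section Transversal.
Variable U : {set 'I_N}.
Hypothesis TU : {in U, forall x, T x \in U}.
Hypothesis g_inj : {in U &, forall x y, g x = g y -> fconnect tau x y}.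
Local Notation S := (block_reversal U).

Let FixS := [set x in U | S x == x].
Let FixTS := [set x in U | T (S x) == x].

Lemma card_FixS : #|FixS| <= size (undup [seq a x | x <- enum 'I_N]).
Proof.
rewrite cardE -(size_map a); apply: uniq_leq_size => [|k /mapP[x _ ->]]; last first.
  by rewrite mem_undup map_f // mem_enum.
rewrite map_inj_in_uniq ?enum_uniq // => x y; rewrite !mem_enum !inE.
move=> /andP[xU /eqP Sx] /andP[yU /eqP Sy] eq_a.
exact: block_reversal_fixed_uniq Sx Sy.
Qed.

Lemma card_FixTS : #|FixTS| <= 1.
Proof.
apply/card_le1_eqP => y x; rewrite !inE => /andP[yU /eqP Sy] /andP[xU /eqP Sx].
exact: T_block_reversal_fixed_uniq Sy.
Qed.

(** On a cycle of length [p], [S x] is both [iter k tau x] and [iter (k + p) tau x], and halving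
    each exponent gives a fixed point. For odd [p] the exponents differ in parity, so one point is
    fixed by [S] and the other by [T \o S]. For even [p] both are fixed by the same map, and they
    must be shown distinct. *)
Lemma two_fixed_points x : x \in U ->
  1 < #|[set y in FixS | g y == g x]| + #|[set y in FixTS | g y == g x]|.
Proof.
move=> xU; have Sx_x : fconnect tau x (S x).
  by apply: g_inj; rewrite ?block_reversal_in // orbit_necklace_block_reversal.
set p := fingraph.order tau x; have p_gt0 : 0 < p by apply: fingraph.order_gt0.
pose k := findex tau x (S x); have lt_kp : k < p by apply: findex_max.
have Sk : S x = iter k tau x by rewrite iter_findex.
have Skp : S x = iter (k + p) tau x.
  by rewrite iterD (iter_order (@perm_inj _ tau)).
have mem_iter i : iter i tau x \in U /\ g (iter i tau x) = g x.
  split; first exact: iter_tau_in.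
  by rewrite -(orbit_necklace_fconnect (fconnect_iter tau i x)).
have [iU ig] := mem_iter k./2; have [jU jg] := mem_iter (k + p)./2.
have := iter_half_fixed TU xU Sk; have := iter_half_fixed TU xU Skp.
rewrite oddD; set y := iter k./2 _ _ in iU ig *.
set z := iter (k + p)./2 _ _ in jU jg *.
(* The two half exponents are below [p] and differ by [p./2], which is positive for even [p]. *)
have yz : odd p = false -> y != z.
  move=> p_even; apply/eqP => /(congr1 (findex tau x)).
  by rewrite /y /z !findex_iter -/p; lia.
have gt0 (A : {set 'I_N}) u : u \in A -> 0 < #|A|.
  by move=> uA; apply/card_gt0P; exists u.
have gt1 (A : {set 'I_N}) : y != z -> y \in A -> z \in A -> 1 < #|A|.
  by move=> neq_yz yA zA; apply/card_gt1P; exists y, z.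
case: (odd k); case: (odd p) yz => //= yz fix_z fix_y.
- apply: (@leq_add 1 1).
    by apply: (gt0 _ z); rewrite !inE jU fix_z jg !eqxx.
  by apply: (gt0 _ y); rewrite !inE iU fix_y ig !eqxx.
- apply: leq_trans (leq_addl _ _); apply: (gt1 _ (yz erefl)).
    by rewrite !inE iU fix_y ig !eqxx.
  by rewrite !inE jU fix_z jg !eqxx.
- apply: (@leq_add 1 1).
    by apply: (gt0 _ y); rewrite !inE iU fix_y ig !eqxx.
  by apply: (gt0 _ z); rewrite !inE jU fix_z jg !eqxx.
- apply: leq_trans (leq_addr _ _); apply: (gt1 _ (yz erefl)).
    by rewrite !inE iU fix_y ig !eqxx.
  by rewrite !inE jU fix_z jg !eqxx.
Qed.

Lemma size_transversal (s : seq necklace) : uniq s ->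
    {in s, forall v, exists2 x, x \in U & g x = v} ->
  size s <= uphalf (size (undup [seq a x | x <- enum 'I_N])).
Proof.
move=> s_uniq sU.
(* As [s] has no repetition, each point of [A] is counted for at most one necklace. *)
have fibers (A : {set 'I_N}) : \sum_(v <- s) #|[set y in A | g y == v]| <= #|A|.
  under eq_bigr => v _ do rewrite -sum1dep_card big_mkcondr /=.
  rewrite exchange_big /= -sum1_card; apply: leq_sum => x _.
  by rewrite -big_mkcond sum1_count (eq_count (a2 := pred1 (g x))) ?count_uniq_mem ?leq_b1.
have : \sum_(v <- s) 2 <= #|FixS| + #|FixTS|.
  apply: leq_trans (leq_add (fibers _) (fibers _)); rewrite -big_split /=.
  rewrite big_seq [leqRHS]big_seq; apply: leq_sum => v /sU[x xU <-].
  exact: two_fixed_points.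
rewrite big_const_seq count_predT iter_addn_0.
have := card_FixS; have := card_FixTS; lia.
Qed.

End Transversal.

(** [r] picks one point per necklace, and [U] is the union of the cycles of the picked points. *)
Lemma exists_transversal : exists U : {set 'I_N},
  [/\ {in U, forall x, T x \in U},
      {in U &, forall x y, g x = g y -> fconnect tau x y}
    & forall x, exists2 y, y \in U & g y = g x].
Proof.
have tau_sym := fconnect_sym (@perm_inj _ tau).
pose r x := odflt x [pick y | g y == g x].
have gr x : g (r x) = g x by rewrite /r; case: pickP => //= y /eqP.
(* The defaults [x] and [y] of [odflt] differ but are never reached, since [y] itself satisfies the
   predicate. *)
have r_eq x y : g x = g y -> r x = r y.
  by rewrite /r => ->; case: pickP => // /(_ y); rewrite eqxx.
exists [set x | fconnect tau (r x) x]; split=> [x|x y|x].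
- rewrite !inE => rx; rewrite fconnect_T (r_eq (T x) x) //.
  by apply/esym/orbit_necklace_fconnect; rewrite fconnect_T.
- rewrite !inE => rx ry eq_g; rewrite tau_sym in rx; apply: connect_trans rx _.
  by rewrite (r_eq _ _ eq_g).
- by exists (r x) => //; rewrite inE (r_eq _ _ (gr x)).
Qed.

Lemma size_orbit_necklaces :
  size (undup [seq g x | x <- enum 'I_N])
    <= uphalf (size (undup [seq a x | x <- enum 'I_N])).
Proof.
have [U [TU g_inj U_full]] := exists_transversal.
apply: (size_transversal TU g_inj); first exact: undup_uniq.
by move=> v; rewrite mem_undup => /mapP[x _ ->]; apply: U_full.
Qed.

End DiscreteInterval.

(** * The standard permutation as an interval exchange *)

Section Numbering.
Variable w : word.

(** [numbering] is sorted for the lexicographic order [r] on letter, then position, so indices in it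
    compare as [r] does. *)
Lemma number_lt (i j : 'I_(size w)) :
  (letter i < letter j) || (letter i == letter j) && (i < j) ->
  Defs.number i < Defs.number j.
Proof.
pose r := [rel i j : 'I_(size w) |
  (letter i < letter j) || (letter i == letter j) && (i < j)].
move=> rij; have {}rij : r i j by [].
have r_tr : transitive r by move=> y x z /=; lia.
have r_sorted : sorted r (numbering w).
  apply: pairwise_sorted; rewrite /numbering.
  have : pairwise ltn (sort leq (undup w)).
    rewrite -sorted_pairwise; last exact: ltn_trans.
    by rewrite ltn_sorted_uniq_leq sort_uniq undup_uniq sort_sorted //; apply: leq_total.
  elim: (sort _ _) => //= b s IHs /andP[/allP lt_b /IHs s_pw].
  rewrite pairwise_cat s_pw andbT; apply/andP; split.
    apply/allrelP => x y; rewrite mem_filter => /andP[/eqP x_b _].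
    case/flattenP => _ /mapP[c c_s ->]; rewrite mem_filter => /andP[/eqP y_c _] /=.
    by have lt_bc : b < c := lt_b c c_s; rewrite x_b y_c lt_bc.
  have sub := sub_in_pairwise (P := [pred x | letter x == b])
    (r := relpre val ltn) (r' := r).
  apply: sub; last 2 first.
  - by apply/allP => x; rewrite mem_filter => /andP[].
  - apply: pairwise_filter; rewrite -sorted_pairwise; last by move=> ? ? ?; apply: ltn_trans.
    by rewrite -sorted_map val_enum_ord iota_ltn_sorted.
  by move=> x y /= /eqP -> /eqP -> lt_xy; rewrite eqxx lt_xy orbT.
rewrite ltnNge leq_eqVlt; apply/negP => /predU1P[/val_inj/number_inj eq_ji|lt_ji].
  by move: rij; rewrite eq_ji /=; lia.
have := sorted_ltn_index r_tr r_sorted; move=> /(_ j i); rewrite !mem_numbering.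
by move=> /(_ isT isT lt_ji); move: rij => /=; lia.
Qed.

Lemma distinct_necklaces_Phi : sorted geq w ->
  distinct_necklaces (Phi w) <= uphalf (size (undup w)).
Proof.
move=> w_sorted.
have letters : [seq letter i | i <- enum 'I_(size w)] = w.
  exact: map_tnth_enum (in_tuple w).
have := @size_orbit_necklaces _ (st w) (@letter w) _ _ _.
rewrite letters => le_size; apply: leq_trans (le_size _ _ _).
- rewrite /distinct_necklaces; apply: uniq_leq_size; first exact: fset_uniq.
  (* The necklaces of the cycle roots are among those read from arbitrary positions. *)
  move=> v; rewrite msuppE (perm_mem (perm_eq_seq_mset _)) mem_undup.
  by case/mapP => j _ ->; apply/map_f; rewrite mem_enum.
- move=> x y lt_xy; rewrite /letter !(tnth_nth 0) /=.
  by apply: (sorted_ltn_nth _ 0 w_sorted); rewrite ?inE //; move=> ? ? ?; lia.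
- by move=> x y lt_a; rewrite !permE; apply: number_lt; rewrite lt_a.
- by move=> x y eq_a lt_xy; rewrite !permE; apply: number_lt; rewrite eq_a eqxx lt_xy orbT.
Qed.

End Numbering.

Lemma sorted_decreasing_word n (alpha : (n - 1).-tuple nat) :
  sorted geq (decreasing_word alpha).
Proof.
apply: pairwise_sorted; rewrite /decreasing_word.
have : pairwise (fun i j : 'I_(n - 1) => j < i) (rev (enum 'I_(n - 1))).
  rewrite -sorted_pairwise; last by move=> ? ? ? lt1 lt2; apply: ltn_trans lt2 lt1.
  rewrite rev_sorted -[sorted _ _]/(sorted (relpre val ltn) _) -sorted_map.
  by rewrite val_enum_ord iota_ltn_sorted.
elim: (rev _) => //= i s IHs /andP[/allP lt_i /IHs s_pw].
rewrite pairwise_cat s_pw andbT; apply/andP; split.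
  apply/allrelP => _ y /nseqP[-> _] /flattenP[_ /mapP[j j_s ->] /nseqP[-> _]].
  by have := lt_i j j_s => /=; lia.
apply/(pairwiseP 0) => k l; rewrite !inE size_nseq => lt_k lt_l _ /=.
by rewrite !nth_nseq lt_k lt_l.
Qed.

(* [uphalf m] is the ceiling of m / 2. *)
Theorem corollary1p3 (n : nat) (hn : 1 <= n) (alpha : (n - 1).-tuple nat) :
  distinct_necklaces (Phi (decreasing_word alpha)) <= uphalf (n - 1).
Proof.
apply: leq_trans (distinct_necklaces_Phi (sorted_decreasing_word alpha)) _.
(* Some exponents may vanish, so the letters that occur only form a subset of the [n - 1] values
   [i.+2]. *)
apply: uphalf_leq; rewrite -[leqRHS]size_enum_ord -(size_map (fun i : 'I_(n - 1) => i.+2)).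
apply: uniq_leq_size; first exact: undup_uniq.
move=> k; rewrite mem_undup => /flattenP[_ /mapP[i _ ->] /nseqP[-> _]].
by rewrite (map_f (fun i : 'I_(n - 1) => i.+2)) // mem_enum.
Qed.
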